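(* Let $\kappa>0$, $h>0$, and let $B=B(x_0,h)\subset\mathbb{R}^2$ be the disk with centre $x_0$ and radius $h$. With $(\rho,\psi)$ polar coordinates centred at $x_0$, let $\varphi_m(\rho,\psi)=J_m(\kappa\rho)e^{im\psi}$ for $m\in\mathbb{Z}$. Then the functions $\varphi_m$ are orthogonal in the scaled Cauchy trace inner product $\langle\cdot,\cdot\rangle_{\mathrm{tr}}$ on $\partial B$: for all $m,n\in\mathbb{Z}$, $$\langle\varphi_m,\varphi_n\rangle_{\mathrm{tr}}=\tau_m^2\,\delta_{mn},\qquad \tau_m^2=2\pi h\kappa\big(J_m(\kappa h)^2+J_m'(\kappa h)^2\big),$$ and $\tau_m>0$ for every $m\in\mathbb{Z}$.
   Context: $J_m$ is the Bessel function of the first kind of integer order $m$. The scaled Cauchy trace inner product on $\partial B$, $B=B(x_0,h)$, is $$\langle v,w\rangle_{\mathrm{tr}}=\int_{\partial B}\big(\kappa\, v\,\overline{w}+\kappa^{-1}\,\partial_n v\,\overline{\partial_n w}\big)\,ds,$$ where $\partial_n$ is the outward normal derivative on the circle $\partial B$. $\tau_m$ denotes the nonnegative square root of $\tau_m^2$. *)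

(* Defs.v *)
From Stdlib Require Import Reals ZArith Lra.
From Coquelicot Require Import Coquelicot.

Local Open Scope R_scope.

Definition besselJ_nat (n : nat) (x : R) : R :=
  Series (fun k : nat =>
    (-1) ^ k / (INR (fact k) * INR (fact (k + n))) * (x / 2) ^ (2 * k + n)).

(* Negative orders: J_{-n} = (-1)^n J_n.  This is the general series
   sum_k (-1)^k / (k! Gamma (k + m + 1)) (x / 2)^(2 k + m)
   with 1 / Gamma = 0 at the poles of Gamma. *)
Definition besselJ (m : Z) (x : R) : R :=
  if Z_le_dec 0 m then besselJ_nat (Z.to_nat m) x
  else (-1) ^ Z.to_nat (- m) * besselJ_nat (Z.to_nat (- m)) x.

Definition plane : Type := (R * R)%type.

Definition radius (x0 x : plane) : R :=
  sqrt ((fst x - fst x0) ^ 2 + (snd x - snd x0) ^ 2).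

(* Values in (-PI, PI]; the value at x = x0 is irrelevant. *)
Definition angle (x0 x : plane) : R :=
  let a := acos ((fst x - fst x0) / radius x0 x) in
  if Rle_dec (snd x0) (snd x) then a else - a.

Definition circle (x0 : plane) (h theta : R) : plane :=
  (fst x0 + h * cos theta, snd x0 + h * sin theta).

Lemma circle_radius_angle (x0 x : plane) :
  circle x0 (radius x0 x) (angle x0 x) = x.
Proof.
destruct x0 as [a b], x as [c d].
unfold circle, angle, radius; simpl fst; simpl snd.
set (u := c - a); set (v := d - b); set (r := sqrt (u ^ 2 + v ^ 2)).
assert (Hr0 : 0 <= r) by apply sqrt_pos.
assert (Hr2 : r * r = u ^ 2 + v ^ 2) by (apply sqrt_sqrt; nra).
destruct (Req_dec r 0) as [Hr | Hr].
- assert (u = 0) by nra; assert (v = 0) by nra.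
  rewrite Hr; unfold u, v in *; f_equal; lra.
- assert (Hb : -1 <= u / r <= 1).
  { split; [apply Rle_div_r | apply Rle_div_l]; nra. }
  assert (Hs : r * sqrt (1 - (u / r)²) = Rabs v).
  { rewrite <- (sqrt_Rsqr r) at 1 by lra.
    rewrite <- sqrt_mult_alt by apply Rle_0_sqr.
    rewrite <- sqrt_Rsqr_abs; f_equal.
    unfold Rsqr; field_simplify; [nra | lra]. }
  destruct (Rle_dec b d) as [Hd | Hd].
  + rewrite cos_acos, sin_acos, Hs by lra.
    rewrite Rabs_pos_eq by (unfold v; lra).
    f_equal; [unfold u; field; exact Hr | unfold v; ring].
  + rewrite cos_neg, sin_neg, cos_acos, sin_acos by lra.
    rewrite Ropp_mult_distr_r_reverse, Hs.
    rewrite Rabs_left by (unfold v; lra).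
    f_equal; [unfold u; field; exact Hr | unfold v; ring].
Qed.

Definition expi (t : R) : C := (cos t, sin t).

Definition phi (kappa : R) (x0 : plane) (m : Z) (x : plane) : C :=
  Cmult (RtoC (besselJ m (kappa * radius x0 x))) (expi (IZR m * angle x0 x)).

(* The restriction of v to the line through the point x of the circle of
   centre x0 and radius h, directed by the outward unit normal (x - x0) / h
   and parametrised by signed arc length from x. *)
Definition along_normal (x0 : plane) (h : R) (v : plane -> C) (x : plane)
    (t : R) : C :=
  v (fst x + t * ((fst x - fst x0) / h), snd x + t * ((snd x - snd x0) / h)).

Definition normal_derivative (x0 : plane) (h : R) (v : plane -> C)
    (x : plane) : C :=
  (Derive (fun t => Re (along_normal x0 h v x t)) 0,
   Derive (fun t => Im (along_normal x0 h v x t)) 0).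

Definition trace_density (kappa : R) (x0 : plane) (h : R) (v w : plane -> C)
    (x : plane) : C :=
  Cplus
    (Cmult (RtoC kappa) (Cmult (v x) (Cconj (w x))))
    (Cmult (RtoC (/ kappa))
      (Cmult (normal_derivative x0 h v x)
             (Cconj (normal_derivative x0 h w x)))).

(* ds = h dtheta on the circle. *)
Definition trace_integrand (kappa : R) (x0 : plane) (h : R) (v w : plane -> C)
    (theta : R) : C :=
  Cmult (trace_density kappa x0 h v w (circle x0 h theta)) (RtoC h).

Definition trace_ip (kappa : R) (x0 : plane) (h : R) (v w : plane -> C) : C :=
  RInt (V := C_R_CompleteNormedModule)
    (trace_integrand kappa x0 h v w) 0 (2 * PI).

(* [Derive] and [RInt] are total: this says that [trace_ip] only involves
   genuine derivatives and a genuine integral. *)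
Definition trace_ip_defined (kappa : R) (x0 : plane) (h : R)
    (v w : plane -> C) : Prop :=
  (forall theta : R,
     ex_derive (V := C_R_NormedModule)
       (along_normal x0 h v (circle x0 h theta)) 0 /\
     ex_derive (V := C_R_NormedModule)
       (along_normal x0 h w (circle x0 h theta)) 0) /\
  ex_RInt (V := C_R_NormedModule)
    (trace_integrand kappa x0 h v w) 0 (2 * PI).

Definition tau_sq (kappa h : R) (m : Z) : R :=
  2 * PI * h * kappa *
  (besselJ m (kappa * h) ^ 2 + Derive (besselJ m) (kappa * h) ^ 2).

Definition tau (kappa h : R) (m : Z) : R := sqrt (tau_sq kappa h m).

Definition kronecker (m n : Z) : R := if Z.eq_dec m n then 1 else 0.

(* Main.v *)
Require Import Defs.
From Stdlib Require Import Reals ZArith.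
From Coquelicot Require Import Coquelicot.
From Stdlib Require Import Lra Lia.

(** The statement separates in polar coordinates.  On the circle of radius
    [h], and along each normal line near it, [phi m] is the product of
    [besselJ m (kappa * r)] and [expi (m * theta)]; its normal derivative there
    is the radial derivative [kappa * J_m'(kappa h)] times the same
    exponential.  Hence the trace integrand of [phi m] and [phi n] is a real
    constant times [expi ((m - n) * theta)], whose integral over a period is
    [2 * PI] or [0].

    There remains [tau m > 0], that is, [J_m] and [J_m'] have no common
    positive zero.  Write [J_n x = (x/2)^n C_n(-(x/2)^2)], where
    [C_n z = sum_k z^k / (k! (k+n)!)] is the Bessel-Clifford function.  It is
    entire, and satisfies [C_n' = C_(n+1)] and
    [C_n = (n+1) C_(n+1) + z C_(n+2)].  At a common zero [x > 0] of [J_n] and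
    [J_n'], both [C_n] and [C_(n+1)] vanish at [z = -(x/2)^2 <> 0], and the
    recurrence makes every later [C_k] vanish at [z].  This is impossible,
    because the leading term [1/k!] of [C_k z] dominates the rest of the series
    as soon as [k] is large compared with [z]. *)

Local Open Scope R_scope.

(** * Bessel-Clifford functions *)

(** These are the Taylor coefficients of [x^(-n/2) I_n(2 sqrt x)], an entire
    function of [x].  Factoring [(x/2)^n] out of [J_n x] and using the variable
    [-(x/2)^2] leaves no sign and no parity of exponents to track. *)
Definition clifford_coef (n k : nat) : R := / (INR (fact k) * INR (fact (k + n))).

Definition clifford (n : nat) : R -> R := PSeries (clifford_coef n).

Lemma INR_fact_S (n : nat) : INR (fact (S n)) = INR (S n) * INR (fact n).
Proof. rewrite fact_simpl, mult_INR; reflexivity. Qed.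

Lemma clifford_coef_pos (n k : nat) : 0 < clifford_coef n k.
Proof. apply Rinv_0_lt_compat, Rmult_lt_0_compat; apply INR_fact_lt_0. Qed.

Lemma clifford_radius (n : nat) : CV_radius (clifford_coef n) = p_infty.
Proof.
apply CV_radius_infinite_DAlembert.
- intros k; apply Rgt_not_eq, clifford_coef_pos.
- apply is_lim_seq_le_le with (fun _ => 0) (fun k => / INR (S k)).
  + intros k.
    rewrite Rabs_pos_eq
      by (apply Rlt_le, Rdiv_lt_0_compat; apply clifford_coef_pos).
    split; [apply Rlt_le, Rdiv_lt_0_compat; apply clifford_coef_pos |].
    unfold clifford_coef; change (S k + n)%nat with (S (k + n)).
    rewrite !INR_fact_S.
    pose proof (INR_fact_lt_0 k); pose proof (INR_fact_lt_0 (k + n)).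
    pose proof (lt_0_INR (S k) ltac:(lia)).
    assert (1 <= INR (S (k + n))) by (rewrite S_INR; pose proof (pos_INR (k + n)); lra).
    replace (_ / _) with (/ INR (S k) * / INR (S (k + n))) by (field; lra).
    rewrite <- (Rmult_1_r (/ INR (S k))) at 2.
    apply Rmult_le_compat_l; [apply Rlt_le, Rinv_0_lt_compat; lra |].
    rewrite <- Rinv_1; apply Rinv_le_contravar; lra.
  + apply is_lim_seq_const.
  + apply is_lim_seq_incr_1 with (u := fun k => / INR k).
    apply (is_lim_seq_inv _ p_infty); [apply is_lim_seq_INR | easy].
Qed.

Lemma ex_clifford (n : nat) (z : R) : ex_pseries (clifford_coef n) z.
Proof. apply CV_radius_inside; rewrite clifford_radius; exact I. Qed.

Lemma is_derive_clifford (n : nat) (z : R) :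
  is_derive (clifford n) z (clifford (S n) z).
Proof.
replace (clifford (S n) z) with (PSeries (PS_derive (clifford_coef n)) z).
- apply is_derive_PSeries; rewrite clifford_radius; exact I.
- apply PSeries_ext; intros k; unfold PS_derive, clifford_coef.
  replace (k + S n)%nat with (S k + n)%nat by lia.
  rewrite (INR_fact_S k).
  pose proof (INR_fact_lt_0 k); pose proof (INR_fact_lt_0 (S k + n)).
  pose proof (lt_0_INR (S k) ltac:(lia)).
  field; lra.
Qed.

Lemma clifford_recurrence (n : nat) (z : R) :
  clifford n z = INR (S n) * clifford (S n) z + z * clifford (S (S n)) z.
Proof.
unfold clifford.
rewrite <- PSeries_scal, <- PSeries_incr_1, <- PSeries_plus.
- apply PSeries_ext; intros [| k].
  + change (/ (INR (fact 0) * INR (fact n))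
      = INR (S n) * / (INR (fact 0) * INR (fact (S n))) + 0).
    rewrite INR_fact_S.
    pose proof (INR_fact_lt_0 0); pose proof (INR_fact_lt_0 n).
    pose proof (lt_0_INR (S n) ltac:(lia)).
    field; lra.
  + change (/ (INR (fact (S k)) * INR (fact (S k + n)))
      = INR (S n) * / (INR (fact (S k)) * INR (fact (S k + S n)))
        + / (INR (fact k) * INR (fact (k + S (S n))))).
    replace (S k + S n)%nat with (S (S k + n)) by lia.
    replace (k + S (S n))%nat with (S (S k + n)) by lia.
    rewrite (INR_fact_S k), (INR_fact_S (S k + n)).
    pose proof (INR_fact_lt_0 k); pose proof (INR_fact_lt_0 (S k + n)).
    pose proof (lt_0_INR (S k) ltac:(lia)).
    pose proof (lt_0_INR (S n) ltac:(lia)).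
    replace (INR (S (S k + n))) with (INR (S n) + INR (S k))
      by (rewrite <- plus_INR; f_equal; lia).
    field; lra.
- apply (@ex_pseries_scal R_AbsRing R_NormedModule);
    [apply Rmult_comm | apply ex_clifford].
- apply ex_pseries_incr_1, ex_clifford.
Qed.

(** Since [(k+1)! (k+1+n)! >= k! (n+1)!], the series without its first term is
    dominated by [|z| / (n+1)!] times the exponential series of [|z|].
    Relative to the first term [1/n!] this is [|z| exp |z| / (n+1)], which tends
    to [0] as [n] grows. *)
Lemma clifford_tail_bound (n : nat) (z : R) :
  Rabs (clifford n z - / INR (fact n))
    <= Rabs z * (/ INR (fact (S n)) * exp (Rabs z)).
Proof.
unfold clifford.
rewrite PSeries_decr_1 by apply ex_clifford.
replace (clifford_coef n 0) with (/ INR (fact n))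
  by (unfold clifford_coef; simpl; rewrite Rmult_1_l; reflexivity).
replace (_ + _ - _) with (z * PSeries (PS_decr_1 (clifford_coef n)) z) by ring.
rewrite Rabs_mult; apply Rmult_le_compat_l; [apply Rabs_pos |].
assert (Hexp : is_series (fun k => / INR (fact (S n)) * (/ INR (fact k) * Rabs z ^ k))
                 (/ INR (fact (S n)) * exp (Rabs z))).
{ apply (is_series_scal (K := R_AbsRing) (V := R_NormedModule)).
  apply is_series_ext with (2 := is_exp_Reals (Rabs z)).
  intros k; rewrite pow_n_pow; unfold scal; simpl; unfold mult; simpl; ring. }
rewrite <- (is_series_unique _ _ Hexp).
assert (Hk : forall k, 0 <= Rabs (PS_decr_1 (clifford_coef n) k * z ^ k)
    <= / INR (fact (S n)) * (/ INR (fact k) * Rabs z ^ k)).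
{ intros k; split; [apply Rabs_pos |].
  rewrite Rabs_mult, RPow_abs, <- Rmult_assoc.
  apply Rmult_le_compat_r; [apply Rabs_pos |].
  unfold PS_decr_1; rewrite Rabs_pos_eq by apply Rlt_le, clifford_coef_pos.
  unfold clifford_coef; rewrite <- Rinv_mult.
  pose proof (INR_fact_lt_0 k); pose proof (INR_fact_lt_0 (S n)).
  apply Rinv_le_contravar; [apply Rmult_lt_0_compat; assumption |].
  rewrite Rmult_comm.
  apply Rmult_le_compat; try lra; apply le_INR, fact_le; lia. }
unfold PSeries.
eapply Rle_trans; [apply Series_Rabs | apply Series_le; [exact Hk |]].
- apply (ex_series_le (V := R_CompleteNormedModule))
    with (2 := ex_intro _ _ Hexp).
  intros k; unfold norm; simpl; unfold abs; simpl.
  rewrite Rabs_Rabsolu; apply Hk.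
- exact (ex_intro _ _ Hexp).
Qed.

Lemma clifford_eventually_nonzero (z : R) :
  exists N, forall n, (N <= n)%nat -> clifford n z <> 0.
Proof.
destruct (INR_unbounded (Rabs z * exp (Rabs z))) as [N HN].
exists N; intros n Hn H0.
pose proof (clifford_tail_bound n z) as Hb.
pose proof (INR_fact_lt_0 n) as Hf.
assert (HS : Rabs z * exp (Rabs z) < INR (S n)).
{ apply Rlt_trans with (1 := HN), lt_INR; lia. }
assert (HS0 : 0 < INR (S n)) by (apply lt_0_INR; lia).
rewrite H0, Rminus_0_l, Rabs_Ropp, Rabs_pos_eq in Hb
  by (apply Rlt_le, Rinv_0_lt_compat, Hf).
rewrite INR_fact_S in Hb.
apply (Rmult_le_compat_l (INR (S n) * INR (fact n))) in Hb; [| nra].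
replace (INR (S n) * INR (fact n) * / INR (fact n)) with (INR (S n)) in Hb
  by (field; lra).
replace (INR (S n) * INR (fact n) * _) with (Rabs z * exp (Rabs z)) in Hb
  by (field; lra).
lra.
Qed.

(** The recurrence, divided by [z], propagates a pair of consecutive zeros to
    all higher orders. *)
Lemma clifford_no_common_zero (n : nat) (z : R) :
  z <> 0 -> clifford n z = 0 -> clifford (S n) z <> 0.
Proof.
intros Hz H0 H1.
assert (Hall : forall k, clifford (n + k) z = 0 /\ clifford (S (n + k)) z = 0).
{ induction k as [| k [IH0 IH1]].
  - rewrite Nat.add_0_r; auto.
  - rewrite Nat.add_succ_r; split; [exact IH1 |].
    pose proof (clifford_recurrence (n + k) z) as Hr.
    rewrite IH0, IH1 in Hr.
    apply Rmult_eq_reg_l with z; [lra | exact Hz]. }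
destruct (clifford_eventually_nonzero z) as [N HN].
apply (HN (n + N)%nat); [lia | apply Hall].
Qed.

(** * Bessel functions *)

Lemma besselJ_nat_clifford (n : nat) (x : R) :
  besselJ_nat n x = (x / 2) ^ n * clifford n (- (x / 2) ^ 2).
Proof.
unfold besselJ_nat, clifford, PSeries.
rewrite <- Series_scal_l; apply Series_ext; intros k.
replace (- (x / 2) ^ 2) with (-1 * (x / 2) ^ 2) by ring.
rewrite Rpow_mult_distr, <- pow_mult, pow_add.
unfold clifford_coef; unfold Rdiv; ring.
Qed.

Lemma is_derive_besselJ_nat (n : nat) (x : R) :
  is_derive (besselJ_nat n) x
    (INR n * / 2 * (x / 2) ^ pred n * clifford n (- (x / 2) ^ 2)
     - (x / 2) ^ S n * clifford (S n) (- (x / 2) ^ 2)).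
Proof.
apply is_derive_ext with (fun x => (x / 2) ^ n * clifford n (- (x / 2) ^ 2)).
{ intros t; symmetry; apply besselJ_nat_clifford. }
assert (Hd := is_derive_clifford n (- (x / 2) ^ 2)).
auto_derive; [exists (clifford (S n) (- (x / 2) ^ 2)); exact Hd |].
change (Derive (fun x0 => clifford n x0) _)
  with (Derive (clifford n) (- (x / 2) ^ 2)).
rewrite (is_derive_unique _ _ _ Hd); simpl; unfold Rdiv; field.
Qed.

(** Where [C_n] vanishes, the derivative of [(x/2)^n C_n(-(x/2)^2)] reduces to
    [-(x/2)^(n+1) C_(n+1)(-(x/2)^2)]. *)
Lemma besselJ_nat_no_common_zero (n : nat) (x : R) :
  0 < x -> besselJ_nat n x = 0 -> Derive (besselJ_nat n) x <> 0.
Proof.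
intros Hx H0 H1.
rewrite (is_derive_unique _ _ _ (is_derive_besselJ_nat n x)) in H1.
rewrite besselJ_nat_clifford in H0.
assert (Hp : forall k, (x / 2) ^ k <> 0) by (intros k; apply pow_nonzero; lra).
assert (HC : clifford n (- (x / 2) ^ 2) = 0).
{ apply Rmult_integral in H0; destruct H0 as [H0 | H0]; [| exact H0].
  now destruct (Hp n). }
apply (clifford_no_common_zero n (- (x / 2) ^ 2)); [| exact HC |].
- pose proof (Hp 2%nat); lra.
- rewrite HC in H1.
  apply Rmult_eq_reg_l with ((x / 2) ^ S n); [lra | apply Hp].
Qed.

Lemma besselJ_besselJ_nat (m : Z) :
  exists s, s <> 0 /\ forall x, besselJ m x = s * besselJ_nat (Z.abs_nat m) x.
Proof.
unfold besselJ; destruct (Z_le_dec 0 m) as [Hm | Hm].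
- exists 1; split; [lra |]; intros x.
  rewrite Zabs2Nat.abs_nat_nonneg by exact Hm; ring.
- exists ((-1) ^ Z.to_nat (- m)); split; [apply pow_nonzero; lra |]; intros x.
  replace (Z.abs_nat m) with (Z.to_nat (- m)) by lia; reflexivity.
Qed.

Lemma ex_derive_besselJ (m : Z) (x : R) : ex_derive (besselJ m) x.
Proof.
destruct (besselJ_besselJ_nat m) as [s [_ Hs]].
apply ex_derive_ext with (fun x => s * besselJ_nat (Z.abs_nat m) x).
- intros t; symmetry; apply Hs.
- apply ex_derive_scal; eexists; apply is_derive_besselJ_nat.
Qed.

Lemma besselJ_no_common_zero (m : Z) (x : R) :
  0 < x -> besselJ m x = 0 -> Derive (besselJ m) x <> 0.
Proof.
intros Hx H0 H1.
destruct (besselJ_besselJ_nat m) as [s [Hs0 Hs]].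
rewrite Hs in H0.
rewrite (Derive_ext _ _ _ Hs), Derive_scal in H1.
apply Rmult_integral in H0; apply Rmult_integral in H1.
apply (besselJ_nat_no_common_zero (Z.abs_nat m) x Hx); tauto.
Qed.

Lemma tau_sq_pos (kappa h : R) (m : Z) :
  0 < kappa -> 0 < h -> 0 < tau_sq kappa h m.
Proof.
intros Hk Hh; unfold tau_sq.
assert (Hkh : 0 < kappa * h) by now apply Rmult_lt_0_compat.
pose proof PI_RGT_0 as Hpi.
apply Rmult_lt_0_compat; [repeat (lra || apply Rmult_lt_0_compat) |].
destruct (Req_dec (besselJ m (kappa * h)) 0) as [H0 | H0].
- pose proof (besselJ_no_common_zero m _ Hkh H0) as H1.
  rewrite <- !Rsqr_pow2; apply Rsqr_pos_lt in H1.
  pose proof (Rle_0_sqr (besselJ m (kappa * h))); lra.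
- rewrite <- !Rsqr_pow2; apply Rsqr_pos_lt in H0.
  pose proof (Rle_0_sqr (Derive (besselJ m) (kappa * h))); lra.
Qed.

(** * Circular harmonics *)

Lemma expi_plus (a b : R) : expi (a + b) = Cmult (expi a) (expi b).
Proof. unfold expi, Cmult; simpl; rewrite cos_plus, sin_plus; f_equal; ring. Qed.

Lemma expi_opp (a : R) : expi (- a) = Cconj (expi a).
Proof. unfold expi, Cconj; simpl; rewrite cos_neg, sin_neg; reflexivity. Qed.

(** For integer [m], [expi (m * a)] is the [m]-th power of [expi a], so the
    branch chosen for the angle of a point does not affect [phi m] there. *)
Lemma expi_IZR_mult (m : Z) (a b : R) :
  expi a = expi b -> expi (IZR m * a) = expi (IZR m * b).
Proof.
intros Hab; induction m as [| m IH | m IH] using Z.peano_ind.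
- rewrite !Rmult_0_l; reflexivity.
- unfold Z.succ; rewrite plus_IZR, !Rmult_plus_distr_r, !Rmult_1_l.
  rewrite !expi_plus, IH, Hab; reflexivity.
- unfold Z.pred; rewrite plus_IZR, !Rmult_plus_distr_r.
  replace (-1 * a) with (- a) by ring; replace (-1 * b) with (- b) by ring.
  rewrite !expi_plus, IH, !expi_opp, Hab; reflexivity.
Qed.

Lemma expi_IZR_mult_2PI (k : Z) : expi (IZR k * (2 * PI)) = RtoC 1.
Proof.
rewrite (expi_IZR_mult k (2 * PI) 0).
- rewrite Rmult_0_r; unfold expi; rewrite cos_0, sin_0; reflexivity.
- unfold expi; rewrite cos_2PI, sin_2PI, cos_0, sin_0; reflexivity.
Qed.

Lemma is_RInt_expi_period (k : Z) :
  is_RInt (V := C_R_NormedModule) (fun t => expi (IZR k * t)) 0 (2 * PI)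
    (RtoC (2 * PI * kronecker k 0)).
Proof.
unfold kronecker; destruct (Z.eq_dec k 0) as [-> | Hk].
- apply is_RInt_ext with (fun _ => RtoC 1).
  { intros t _; rewrite Rmult_0_l; unfold expi; rewrite cos_0, sin_0; reflexivity. }
  replace (RtoC (2 * PI * 1)) with (scal (V := C_R_NormedModule) (2 * PI - 0) (RtoC 1)).
  + apply is_RInt_const.
  + unfold scal; simpl; unfold prod_scal, scal; simpl; unfold mult; simpl.
    unfold RtoC; f_equal; ring.
- assert (Hk' : IZR k <> 0) by now apply not_0_IZR.
  replace (RtoC (2 * PI * 0)) with
    (minus (sin (IZR k * (2 * PI)) / IZR k) (sin (IZR k * 0) / IZR k),
     minus (- cos (IZR k * (2 * PI)) / IZR k) (- cos (IZR k * 0) / IZR k)).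
  + apply (is_RInt_fct_extend_pair (U := R_NormedModule) (V := R_NormedModule));
      simpl.
    * apply (is_RInt_derive (V := R_CompleteNormedModule)
               (fun t => sin (IZR k * t) / IZR k)).
      -- intros t _; auto_derive; [easy | field; exact Hk'].
      -- intros t _; apply (ex_derive_continuous (V := R_NormedModule)).
         auto_derive; easy.
    * apply (is_RInt_derive (V := R_CompleteNormedModule)
               (fun t => - cos (IZR k * t) / IZR k)).
      -- intros t _; auto_derive; [easy | field; exact Hk'].
      -- intros t _; apply (ex_derive_continuous (V := R_NormedModule)).
         auto_derive; easy.
  + pose proof (expi_IZR_mult_2PI k) as Hper.
    injection Hper as Hcos Hsin.
    rewrite Hsin, Hcos, !Rmult_0_r, sin_0, cos_0.
    unfold minus, plus, opp, RtoC; simpl; f_equal; field; exact Hk'.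
Qed.

(** * Separation of variables on the circle *)

Lemma radius_circle (x0 : plane) (r theta : R) :
  0 <= r -> radius x0 (circle x0 r theta) = r.
Proof.
intros Hr; unfold radius, circle; simpl.
replace (_ + _) with (r * r * ((sin theta)² + (cos theta)²)) by (unfold Rsqr; ring).
rewrite sin2_cos2, Rmult_1_r; apply sqrt_square, Hr.
Qed.

Lemma expi_angle_circle (x0 : plane) (r theta : R) :
  0 < r -> expi (angle x0 (circle x0 r theta)) = expi theta.
Proof.
intros Hr.
pose proof (circle_radius_angle x0 (circle x0 r theta)) as H.
rewrite radius_circle in H by lra.
set (a := angle x0 (circle x0 r theta)) in *.
unfold circle in H; injection H as Hc Hs.
unfold expi; f_equal; apply Rmult_eq_reg_l with r; lra.
Qed.

Lemma phi_circle (kappa : R) (x0 : plane) (m : Z) (r theta : R) :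
  0 < r ->
  phi kappa x0 m (circle x0 r theta)
    = Cmult (RtoC (besselJ m (kappa * r))) (expi (IZR m * theta)).
Proof.
intros Hr; unfold phi.
rewrite radius_circle by lra.
rewrite (expi_IZR_mult m _ _ (expi_angle_circle x0 r theta Hr)); reflexivity.
Qed.

Lemma along_normal_circle (x0 : plane) (h : R) (v : plane -> C) (theta t : R) :
  0 < h ->
  along_normal x0 h v (circle x0 h theta) t = v (circle x0 (h + t) theta).
Proof.
intros Hh; unfold along_normal, circle; simpl.
f_equal; f_equal; field; lra.
Qed.

Lemma is_derive_along_normal_phi
    (kappa h : R) (x0 : plane) (m : Z) (theta : R) :
  0 < h ->
  is_derive (V := C_R_NormedModule)
    (along_normal x0 h (phi kappa x0 m) (circle x0 h theta)) 0
    (Cmult (RtoC (kappa * Derive (besselJ m) (kappa * h)))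
       (expi (IZR m * theta))).
Proof.
intros Hh.
assert (HRC : forall (r : R) (z : C),
  scal (V := C_R_NormedModule) r z = Cmult (RtoC r) z).
{ intros r [a b]; unfold scal, Cmult, RtoC; simpl.
  unfold prod_scal, scal; simpl; unfold mult; simpl; f_equal; ring. }
rewrite <- HRC.
apply is_derive_ext_loc with
  (fun t => scal (V := C_R_NormedModule) (besselJ m (kappa * (h + t)))
              (expi (IZR m * theta))).
(* Past the centre, for t < -h, the angle jumps by PI: the formula is local. *)
- exists (mkposreal h Hh); intros t Ht.
  unfold ball in Ht; simpl in Ht; unfold AbsRing_ball, abs, minus, plus, opp in Ht.
  simpl in Ht; apply Rabs_def2 in Ht.
  rewrite along_normal_circle, phi_circle, HRC by lra; reflexivity.
- apply (is_derive_scal_l (K := R_AbsRing) (V := C_R_NormedModule)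
           (fun t => besselJ m (kappa * (h + t)))).
  assert (He : ex_derive (besselJ m) (kappa * (h + 0))) by apply ex_derive_besselJ.
  auto_derive; [exact He |].
  change (Derive (fun x => besselJ m x)) with (Derive (besselJ m)).
  rewrite Rplus_0_r; ring.
Qed.

(** Serves to pass from the complex derivative along the normal to the
    derivatives of its real and imaginary parts. *)
Lemma is_derive_comp_linear (f : R -> C) (g : C -> R) (x : R) (l : C) :
  is_linear (U := C_R_NormedModule) (V := R_NormedModule) g ->
  is_derive (V := C_R_NormedModule) f x l ->
  is_derive (fun t => g (f t)) x (g l).
Proof.
intros Hg Hf.
apply filterdiff_ext_lin with (fun y : R => g (scal (V := C_R_NormedModule) y l)).
- apply (filterdiff_comp' (V := C_R_NormedModule) f g x); [exact Hf |].
  now apply filterdiff_linear.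
- intros y; apply (linear_scal (U := C_R_NormedModule) (V := R_NormedModule) g Hg).
Qed.

Lemma normal_derivative_phi (kappa h : R) (x0 : plane) (m : Z) (theta : R) :
  0 < h ->
  normal_derivative x0 h (phi kappa x0 m) (circle x0 h theta)
    = Cmult (RtoC (kappa * Derive (besselJ m) (kappa * h)))
        (expi (IZR m * theta)).
Proof.
intros Hh; unfold normal_derivative.
pose proof (is_derive_along_normal_phi kappa h x0 m theta Hh) as Hd.
rewrite (surjective_pairing (Cmult _ _)); f_equal; apply is_derive_unique.
- apply (is_derive_comp_linear _ Re _ _ (is_linear_fst (U := R_NormedModule)) Hd).
- apply (is_derive_comp_linear _ Im _ _ (is_linear_snd (U := R_NormedModule)) Hd).
Qed.

Lemma trace_integrand_phi (kappa h : R) (x0 : plane) (m n : Z) (theta : R) :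
  0 < kappa -> 0 < h ->
  trace_integrand kappa x0 h (phi kappa x0 m) (phi kappa x0 n) theta
    = scal (V := C_R_NormedModule)
        (h * kappa *
          (besselJ m (kappa * h) * besselJ n (kappa * h)
           + Derive (besselJ m) (kappa * h) * Derive (besselJ n) (kappa * h)))
        (expi (IZR (m - n) * theta)).
Proof.
intros Hk Hh; unfold trace_integrand, trace_density.
rewrite !normal_derivative_phi, !phi_circle by exact Hh.
rewrite minus_IZR, Rmult_minus_distr_r; unfold Rminus at 1.
rewrite expi_plus, expi_opp.
set (a := expi (IZR m * theta)); set (b := expi (IZR n * theta)).
destruct a as [a1 a2], b as [b1 b2].
unfold scal, Cplus, Cmult, Cconj, RtoC; simpl.
unfold prod_scal, scal; simpl; unfold mult; simpl.
f_equal; field; lra.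
Qed.

Lemma is_RInt_trace_integrand_phi (kappa h : R) (x0 : plane) (m n : Z) :
  0 < kappa -> 0 < h ->
  is_RInt (V := C_R_NormedModule)
    (trace_integrand kappa x0 h (phi kappa x0 m) (phi kappa x0 n)) 0 (2 * PI)
    (RtoC (tau_sq kappa h m * kronecker m n)).
Proof.
intros Hk Hh.
eapply is_RInt_ext.
{ intros t _; symmetry; now apply trace_integrand_phi. }
replace (RtoC (tau_sq kappa h m * kronecker m n)) with
  (scal (V := C_R_NormedModule)
    (h * kappa *
      (besselJ m (kappa * h) * besselJ n (kappa * h)
       + Derive (besselJ m) (kappa * h) * Derive (besselJ n) (kappa * h)))
    (RtoC (2 * PI * kronecker (m - n) 0))).
- apply (is_RInt_scal (V := C_R_NormedModule)), is_RInt_expi_period.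
- unfold scal, RtoC; simpl; unfold prod_scal, scal; simpl; unfold mult; simpl.
  f_equal; [| ring].
  unfold kronecker, tau_sq.
  destruct (Z.eq_dec m n) as [<- | Hmn].
  + rewrite Z.sub_diag; simpl; ring.
  + destruct (Z.eq_dec (m - n) 0); [lia | ring].
Qed.

Theorem theorem3p1 :
  forall (kappa h : R) (x0 : plane),
    0 < kappa -> 0 < h ->
    (forall m n : Z,
       trace_ip_defined kappa x0 h (phi kappa x0 m) (phi kappa x0 n) /\
       trace_ip kappa x0 h (phi kappa x0 m) (phi kappa x0 n)
         = RtoC (tau_sq kappa h m * kronecker m n)) /\
    (forall m : Z, 0 < tau kappa h m).
Proof.
intros kappa h x0 Hk Hh; split.
- intros m n.
  pose proof (is_RInt_trace_integrand_phi kappa h x0 m n Hk Hh) as HI.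
  split; [split |].
  + intros theta; split; eexists; now apply is_derive_along_normal_phi.
  + eexists; exact HI.
  + apply (is_RInt_unique (V := C_R_CompleteNormedModule)), HI.
- intros m; apply sqrt_lt_R0, tau_sq_pos; assumption.
Qed.
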